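(* Let $k,m\ge1$ be integers and $n=mk$. Let $\tilde Z_{n,k}$ be the batching estimator with batch size $k$ and $U_{n,k}$ the $U$-statistic with resample size $k$. Denote by $\{\xi_1,\ldots,\xi_n\}$ the unordered collection of values of the data. Assume $E[H_k(\xi_1,\ldots,\xi_k)^2]<\infty$. Then $$Var(\tilde Z_{n,k})=Var(U_{n,k})+E\big[Var(\tilde Z_{n,k}\mid\{\xi_1,\ldots,\xi_n\})\big],$$ and hence $Var(\tilde Z_{n,k})\ge Var(U_{n,k})$ for any $k\ge1$.
   Context: $\xi_1,\xi_2,\ldots$ are i.i.d. from a probability distribution $F$ on a measurable space $\Xi$, $\mathcal X$ is a decision space, and $h:\mathcal X\times\Xi\to\mathbb R$ is a cost function (measurability assumed throughout). $H_k(\xi_1,\ldots,\xi_k)=\min_{x\in\mathcal X}\frac1k\sum_{i=1}^kh(x,\xi_i)$. The batching estimator is $\tilde Z_{n,k}=\frac1m\sum_{j=1}^mH_k(\xi_{(j-1)k+1},\ldots,\xi_{jk})$ with $n=mk$. $U_{n,k}$ is the average of $H_k(\xi_{i_1},\ldots,\xi_{i_k})$ over all size-$k$ subsets $\{i_1,\ldots,i_k\}$ of $\{1,\ldots,n\}$. Conditioning on $\{\xi_1,\ldots,\xi_n\}$ means conditioning on the multiset of data values, i.e. on the $\sigma$-algebra of events determined by permutation-invariant functions of $(\xi_1,\ldots,\xi_n)$. *)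

(* Defs.v *)
From HB Require Import structures.
From mathcomp Require Import all_boot all_order all_fingroup all_algebra.
From mathcomp Require Import finmap.
From mathcomp Require Import all_classical all_reals all_analysis.

Set Implicit Arguments.
Unset Strict Implicit.
Unset Printing Implicit Defensive.

Import Order.TTheory GRing.Theory Num.Theory.
Import numFieldNormedType.Exports.

Local Open Scope classical_set_scope.
Local Open Scope ring_scope.

Section iid.
Context d d' (Omega : measurableType d) (Xi : measurableType d') (R : realType).
Variable P : probability Omega R.

Definition mutually_independent (xi : nat -> {RV P >-> Xi}) : Prop :=
  forall (J : {fset nat}) (B : nat -> set Xi),
    (forall i, measurable (B i)) ->
    P (\bigcap_(i in [set` J]) (xi i @^-1` B i)) =
    (\prod_(i <- J) P (xi i @^-1` B i))%E.

(* The laws are compared on measurable sets only: the value of a measure on the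
   other sets is unspecified. *)
Definition iid (F : probability Xi R) (xi : nat -> {RV P >-> Xi}) : Prop :=
  mutually_independent xi /\
  forall i B, measurable B -> distribution P (xi i) B = F B.

End iid.

Section estimators.
Context (R : realType) (X Xi : Type).
Variable h : X -> Xi -> R.

Definition sample_cost k (s : seq Xi) (x : X) : R :=
  k%:R^-1 * \sum_(z <- s) h x z.

(* The optimal value H_k(s), for a list s of k data points. This is the minimum
   whenever the minimum is attained; [inf] is meaningful as soon as the costs
   satisfy [has_inf], i.e. X is nonempty and the costs are bounded below. *)
Definition opt_value k (s : seq Xi) : R := inf (range (sample_cost k s)).

(* Indices start at 0: the data are xs 0, ..., xs (m * k - 1), and batch j is
   xs (j * k), ..., xs (j * k + k - 1). *)
Definition batching_estimator k m (xs : nat -> Xi) : R :=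
  m%:R^-1 * \sum_(j < m) opt_value k (mkseq (fun i => xs (j * k + i)%N) k).

(* [enum S] lists the subset S in increasing order. *)
Definition U_statistic k n (xs : nat -> Xi) : R :=
  'C(n, k)%:R^-1 *
  \sum_(S : {set 'I_n} | #|S| == k) opt_value k [seq xs i | i : 'I_n <- enum S].

End estimators.

Section unordered_data.
Context d d' (Omega : measurableType d) (Xi : measurableType d') (R : realType).

Definition perm_invariant n (f : n.-tuple Xi -> R) : Prop :=
  forall (s : 'S_n) (t : n.-tuple Xi), f [tuple tnth t (s i) | i < n] = f t.

Definition sigma_unordered n (D : Omega -> n.-tuple Xi) : set (set Omega) :=
  <<s [set A | exists f : n.-tuple Xi -> R,
         [/\ measurable_fun [set: n.-tuple Xi] f,
             perm_invariant f &
             exists2 C : set R, measurable C & A = (f \o D) @^-1` C]] >>.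

End unordered_data.

Section conditional_expectation.
Context d (Omega : measurableType d) (R : realType).
Variables (P : probability Omega R) (G : set (set Omega)).

(* Y is a version of E[Z | G], for a sigma-algebra G of measurable sets. *)
Definition is_cond_expectation (Z Y : Omega -> R) : Prop :=
  [/\ forall C : set R, measurable C -> G (Y @^-1` C),
      P.-integrable [set: Omega] (EFin \o Y) &
      forall A, G A ->
        (\int[P]_(w in A) (Y w)%:E = \int[P]_(w in A) (Z w)%:E)%E].

(* An arbitrary version; the default value 0 is only used when there is no
   version, which does not happen for integrable Z. *)
Definition cond_expectation (Z : Omega -> R) : Omega -> R :=
  xget (fun=> 0) [set Y | is_cond_expectation Z Y].

Definition cond_variance (Z : Omega -> R) : Omega -> R :=
  cond_expectation (fun w => (Z w - cond_expectation Z w) ^+ 2).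

End conditional_expectation.

(* Main.v *)
Require Import Defs.
From HB Require Import structures.
From mathcomp Require Import all_boot all_order all_fingroup all_algebra.
From mathcomp Require Import finmap.
From mathcomp Require Import all_classical all_reals all_analysis.
From mathcomp Require Import measurable_realfun.

(** The conditional expectation of the batching estimator Z given the unordered
    data is the U-statistic U, and the theorem is the law of total variance for
    this conditioning.

    The data D = (xi_1, ..., xi_n) is i.i.d., hence exchangeable: its law is
    invariant under permutations of the coordinates ([iid_exchangeable]). An
    event A of the unordered sigma-algebra is D^-1(B) for a set B invariant
    under permutations ([sigma_unordered_preimage]). Therefore g(D) and
    g(permuted D) have the same integral over A, and averaging over all
    permutations shows that E[g(D) | unordered data] = (symmetrize g)(D) for
    every integrable g(D) ([cond_expectation_symmetrize]). This formula is used
    for three functions g, where z and u are Z and U as functions of the data.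

    - For g = z, the symmetrization is u ([symmetrize_batching]). No counting of
      permutations is needed: a permutation carries any list of k distinct
      indices to any other one, so that all the functions H_k(t_i : i in e) have
      the same symmetrization. Both z and u are averages of such functions,
      hence symmetrize z = symmetrize u, and u is already symmetric.
    - For g = (z - u) u, the symmetrization is (u - u) u = 0. Hence Z - U and U
      are orthogonal, and Var Z = Var U + E[(Z - U)^2]
      ([variance_orthogonal_decomposition]).
    - For g = (z - u)^2, the formula provides a version of the conditional
      expectation of (Z - U)^2. The conditional variance is defined from an
      arbitrary version of E[Z | unordered data]; as versions agree almost
      surely, its expectation is E[(Z - U)^2]
      ([expectation_cond_variance]). *)

Set Implicit Arguments.
Unset Strict Implicit.
Unset Printing Implicit Defensive.

Import Order.TTheory GRing.Theory Num.Theory.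
Import numFieldNormedType.Exports.

Local Open Scope classical_set_scope.
Local Open Scope ring_scope.

(** * Symmetrization of functions of the data *)

Section symmetrization.
Context d (T : measurableType d) (R : realType) (n : nat).
Implicit Types (s r : 'S_n) (t : n.-tuple T) (f v : n.-tuple T -> R).

Definition permute s t : n.-tuple T := [tuple tnth t (s i) | i < n].

Lemma permuteM s r t : permute s (permute r t) = permute (s * r)%g t.
Proof. by apply: eq_from_tnth => i; rewrite !tnth_mktuple permM. Qed.

Definition symmetrize f t : R := n`!%:R^-1 * \sum_(s : 'S_n) f (permute s t).

Let fact_neq0 : n`!%:R != 0 :> R.
Proof. by rewrite pnatr_eq0 -lt0n fact_gt0. Qed.

Lemma symmetrize_invariant f : perm_invariant (symmetrize f).
Proof.
move=> r t; rewrite -/(permute r t) /symmetrize; congr (_ * _).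
rewrite [RHS](reindex_inj (mulIg r)).
by apply: eq_bigr => s _; rewrite permuteM.
Qed.

Lemma symmetrize_id f : perm_invariant f -> symmetrize f = f.
Proof.
move=> fi; apply/funext => t; rewrite /symmetrize.
under eq_bigr do rewrite fi.
by rewrite sumr_const card_Sn -[f t *+ _]mulr_natl mulKf.
Qed.

Lemma symmetrize_permute f s :
  symmetrize (fun t => f (permute s t)) = symmetrize f.
Proof.
apply/funext => t; rewrite /symmetrize; congr (_ * _).
rewrite [RHS](reindex_inj (mulgI s)).
by apply: eq_bigr => r _; rewrite permuteM.
Qed.

Lemma symmetrizeMr f v : perm_invariant v ->
  symmetrize (fun t => f t * v t) = fun t => symmetrize f t * v t.
Proof.
move=> vi; apply/funext => t; rewrite /symmetrize -mulrA mulr_suml.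
by congr (_ * _); apply: eq_bigr => s _; rewrite vi.
Qed.

Lemma symmetrizeB f v :
  symmetrize (fun t => f t - v t) = fun t => symmetrize f t - symmetrize v t.
Proof. by apply/funext => t; rewrite /symmetrize sumrB mulrBr. Qed.

(** Both estimators are averages of this kind: they average the optimal value
    over different families of k-subsets of the data. *)
Lemma symmetrize_average (I : finType) (p : pred I) (f : I -> n.-tuple T -> R)
    v :
  (0 < #|p|)%N -> (forall i, p i -> symmetrize (f i) = v) ->
  symmetrize (fun t => #|p|%:R^-1 * \sum_(i | p i) f i t) = v.
Proof.
move=> p_gt0 fv; apply/funext => t.
have p_neq0 : #|p|%:R != 0 :> R by rewrite pnatr_eq0 -lt0n.
transitivity (#|p|%:R^-1 * \sum_(i | p i) symmetrize (f i) t).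
  by rewrite /symmetrize -mulr_sumr -mulr_sumr mulrCA exchange_big.
rewrite (eq_bigr (fun=> v t)) => [|i /fv-> //].
by rewrite sumr_const -[v t *+ _]mulr_natl mulKf.
Qed.

Definition subsample (e : seq 'I_n) t : seq T := [seq tnth t i | i <- e].

Lemma subsample_permute e s t :
  subsample e (permute s t) = subsample (map s e) t.
Proof.
by rewrite /subsample -map_comp; apply: eq_map => i; rewrite /= tnth_mktuple.
Qed.

End symmetrization.

(** Complete both lists to enumerations of all indices and match them position
    by position. *)
Lemma perm_extending n (e e' : seq 'I_n) :
  uniq e -> uniq e' -> size e = size e' -> exists s : 'S_n, map s e = e'.
Proof.
move=> ue ue' see'.
have [x0 _|no_index] := pickP (@predT 'I_n); last first.
  case: e e' see' {ue ue'} => [|i e] [|j e'] // _; first by exists 1%g.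
  by have := no_index i.
pose rest (l : seq 'I_n) := l ++ [seq i <- enum 'I_n | i \notin l].
have rest_uniq l : uniq l -> uniq (rest l).
  move=> ul; rewrite cat_uniq ul filter_uniq ?enum_uniq// andbT.
  by apply/hasPn => i; rewrite mem_filter => /andP[].
have rest_mem l i : i \in rest l.
  by rewrite mem_cat mem_filter mem_enum andbT; case: (i \in l).
have rest_size l : uniq l -> size (rest l) = n.
  move=> ul; rewrite -[RHS]size_enum_ord; apply/perm_size/uniq_perm.
  - exact: rest_uniq.
  - exact: enum_uniq.
  - by move=> i; rewrite rest_mem mem_enum.
have rest_eq : size (rest e') = size (rest e) by rewrite !rest_size.
pose g i := nth i (rest e') (index i (rest e)).
have g_inj : injective g.
  move=> i j gij; have idx l : (index l (rest e) < size (rest e'))%N.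
    by rewrite rest_eq index_mem.
  move/eqP: gij; rewrite /g (set_nth_default i j)// nth_uniq ?rest_uniq//.
  by move=> /eqP /index_inj; apply.
exists (perm g_inj).
apply: (@eq_from_nth _ x0); rewrite size_map// => j je.
rewrite (nth_map x0)// permE /g /rest index_cat mem_nth// index_uniq//.
by rewrite nth_cat -see' je; apply: set_nth_default; rewrite -see'.
Qed.

(** Extend the bijection between the two index lists to a permutation of all
    indices; symmetrization absorbs it. *)
Lemma symmetrize_subsample d (T : measurableType d) (R : realType) n
    (H : seq T -> R) (e e' : seq 'I_n) :
  uniq e -> uniq e' -> size e = size e' ->
  symmetrize (fun t => H (subsample e t)) =
  symmetrize (fun t => H (subsample e' t)).
Proof.
move=> ue ue' /(perm_extending ue ue')[s <-].
rewrite -[LHS](symmetrize_permute _ s); congr symmetrize.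
by apply/funext => t; rewrite subsample_permute.
Qed.

Section estimators_of_tuples.
Context d (Xi : measurableType d) (R : realType) (X : Type).
Variables (h : X -> Xi -> R) (k m : nat).
Let n := (m * k)%N.

Lemma opt_value_eq_sum (a b : seq Xi) :
  (forall x, \sum_(z <- a) h x z = \sum_(z <- b) h x z) ->
  opt_value h k a = opt_value h k b.
Proof.
move=> ab; rewrite /opt_value.
suff -> : sample_cost h k a = sample_cost h k b by [].
by apply/funext => x; rewrite /sample_cost ab.
Qed.

Lemma batch_index_subproof (j : 'I_m) (i : 'I_k) : (j * k + i < n)%N.
Proof.
rewrite (@leq_trans (j * k + k))// ?ltn_add2l//.
by rewrite addnC -mulSn leq_mul2r ltn_ord orbT.
Qed.

Definition batch (j : 'I_m) : seq 'I_n :=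
  [seq Ordinal (batch_index_subproof j i) | i <- enum 'I_k].

Lemma size_batch j : size (batch j) = k.
Proof. by rewrite size_map size_enum_ord. Qed.

Lemma batch_uniq j : uniq (batch j).
Proof.
rewrite map_inj_uniq ?enum_uniq// => i i' [] /eqP.
by rewrite eqn_add2l => /eqP /val_inj.
Qed.

(** Both estimators as functions of the n data points that they use, so that
    permutations of the data act on them. *)
Definition batching_of (t : n.-tuple Xi) : R :=
  m%:R^-1 * \sum_(j < m) opt_value h k (subsample (batch j) t).

Definition U_statistic_of (t : n.-tuple Xi) : R :=
  'C(n, k)%:R^-1 *
  \sum_(S : {set 'I_n} | #|S| == k) opt_value h k (subsample (enum S) t).

Lemma batching_ofE (xs : nat -> Xi) :
  batching_estimator h k m xs = batching_of [tuple xs i | i < n].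
Proof.
congr (_ * _); apply: eq_bigr => j _; congr opt_value.
rewrite /mkseq -val_enum_ord /subsample -!map_comp.
by apply: eq_map => i /=; rewrite tnth_mktuple.
Qed.

Lemma U_statistic_ofE (xs : nat -> Xi) :
  U_statistic h k n xs = U_statistic_of [tuple xs i | i < n].
Proof.
congr (_ * _); apply: eq_bigr => S _; congr opt_value.
by apply: eq_map => i /=; rewrite tnth_mktuple.
Qed.

(** A permutation of the data permutes the k-subsets of indices, and the optimal
    value does not depend on the order in which a subset is listed. *)
Lemma U_statistic_of_invariant : perm_invariant U_statistic_of.
Proof.
move=> s t; rewrite -/(permute s t); congr (_ * _).
have simK : cancel (fun S : {set 'I_n} => s @: S) (fun S => s^-1%g @: S).
  move=> S; rewrite -imset_comp -[RHS]imset_id; apply: eq_imset => i /=.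
  by rewrite permK.
rewrite [RHS](reindex_inj (can_inj simK)); apply: eq_big => [S|S _].
  by rewrite card_imset//; exact: perm_inj.
rewrite subsample_permute; apply: opt_value_eq_sum => x.
by rewrite !big_map !big_enum/= (big_imset _ (in2W (@perm_inj _ s))).
Qed.

(** With e0 the first batch, both estimators have the symmetrization of
    H_k(t_i : i in e0), and the U-statistic equals its own symmetrization. *)
Lemma symmetrize_batching : (0 < k)%N -> (0 < m)%N ->
  symmetrize batching_of = U_statistic_of.
Proof.
move=> k_gt0 m_gt0; pose e0 := batch (Ordinal m_gt0).
rewrite -[RHS]symmetrize_id; last exact: U_statistic_of_invariant.
transitivity (symmetrize (fun t => opt_value h k (subsample e0 t))).
- rewrite -[LHS]/(symmetrize (fun t => m%:R^-1 * _)).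
  rewrite -{1}(card_ord m); apply: symmetrize_average => [|j _].
    by rewrite card_ord.
  by apply: symmetrize_subsample; rewrite ?batch_uniq ?size_batch.
- have card_sub : #|[pred S : {set 'I_n} | #|S| == k]| = 'C(n, k).
    rewrite -[in RHS](card_ord n) -card_draws.
    by apply: eq_card => S; rewrite !inE.
  apply/esym; rewrite -[LHS]/(symmetrize (fun t => 'C(n, k)%:R^-1 * _)).
  rewrite -card_sub; apply: symmetrize_average => [|S /eqP Sk].
    by rewrite card_sub bin_gt0 leq_pmull.
  apply: symmetrize_subsample; rewrite ?batch_uniq ?enum_uniq//.
  by rewrite size_batch -cardE.
Qed.

End estimators_of_tuples.

(** * Exchangeability of i.i.d. data *)

Section tuple_measurability.
Context d (T : measurableType d) (R : realType).

Lemma measurable_permute n (s : 'S_n) :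
  measurable_fun [set: n.-tuple T] (permute s).
Proof.
apply/measurable_fun_tnthP => i.
rewrite (_ : _ \o _ = @tnth n T ^~ (s i)); first exact: measurable_tnth.
by apply/funext => t /=; rewrite tnth_mktuple.
Qed.

Lemma measurable_symmetrize n (f : n.-tuple T -> R) :
  measurable_fun [set: n.-tuple T] f ->
  measurable_fun [set: n.-tuple T] (symmetrize f).
Proof.
move=> mf; apply: measurable_funM => //; apply: measurable_sum => s.
exact: measurableT_comp (measurable_permute s).
Qed.

Lemma measurable_subsample n k (f : seq T -> R) (e : seq 'I_n) :
  size e = k -> measurable_fun [set: k.-tuple T] (fun t : k.-tuple T => f t) ->
  measurable_fun [set: n.-tuple T] (fun t => f (subsample e t)).
Proof.
move=> <- mf.
pose g (t : n.-tuple T) : (size e).-tuple T := map_tuple (tnth t) (in_tuple e).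
apply: (@measurableT_comp _ _ _ _ _ _ (fun t : (size e).-tuple T => f t) _ g)
  => //.
apply/measurable_fun_tnthP => i.
rewrite (_ : _ \o _ = @tnth n T ^~ (tnth (in_tuple e) i)).
  exact: measurable_tnth.
by apply/funext => t /=; rewrite tnth_map.
Qed.

Definition rectangles n : set (set (n.-tuple T)) :=
  [set A | exists2 B : 'I_n -> set T, (forall i, measurable (B i)) &
             A = [set t | forall i, B i (tnth t i)]].

Lemma measurable_rectangles n :
  @measurable _ (n.-tuple T) = <<s @rectangles n >>.
Proof.
apply/seteqP; split.
- apply: smallest_sub; first exact: smallest_sigma_algebra.
  rewrite big_mkcond/= => A; rewrite -bigcup_seq => -[i _] [B mB <-].
  apply: sub_sigma_algebra.
  exists (fun j => if j == i then B else setT) => [j|]; first by case: ifP.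
  rewrite setTI; apply/seteqP; split => t /=.
    by move=> Bt j; case: eqP => [->|].
  by move=> /(_ i); rewrite eqxx.
- apply: smallest_sub; first exact: sigma_algebra_measurable.
  move=> _ [B mB ->]; rewrite [X in measurable X](_ : _ =
    \bigcap_(i in [set: 'I_n]) ((fun t : n.-tuple T => tnth t i) @^-1` B i)).
    apply: fin_bigcap_measurable => // i _; rewrite -[X in measurable X]setTI.
    exact: measurable_tnth.
  by apply/seteqP; split => t /= tB i; [move=> _|]; exact: tB.
Qed.

Lemma rectanglesI n : setI_closed (@rectangles n).
Proof.
move=> _ _ [B mB ->] [C mC ->]; exists (fun i => B i `&` C i) => [i|].
  exact: measurableI.
apply/seteqP; split => t /=.
  by move=> [Bt Ct] i; split.
by move=> BCt; split => i; case: (BCt i).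
Qed.

Lemma rectanglesT n : rectangles [set: n.-tuple T].
Proof. by exists (fun=> setT) => //; apply/seteqP; split. Qed.

End tuple_measurability.

Section exchangeability.
Context d d' (Omega : measurableType d) (T : measurableType d') (R : realType).
Variable P : probability Omega R.

Definition exchangeable n (D : Omega -> n.-tuple T) : Prop :=
  forall (s : 'S_n) (B : set (n.-tuple T)), measurable B ->
    P ((permute s \o D) @^-1` B) = P (D @^-1` B).

(** The right-hand side does not depend on s: this is the invariance of the law
    of the data on rectangles. *)
Lemma iid_rectangle (F : probability T R) (xi : nat -> {RV P >-> T}) n
    (s : 'S_n) (B : 'I_n -> set T) :
  iid F xi -> (forall i, measurable (B i)) ->
  P [set w | forall i : 'I_n, B i (xi (s i) w)] = (\prod_(i < n) F (B i))%E.
Proof.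
move=> [indep law] mB.
pose J : {fset nat} := [fset j in iota 0 n]%fset.
(* C j constrains xi j alone: the constraint on xi (s i) is B i. *)
pose C (j : nat) := if insub j is Some i then B (s^-1 i)%g else setT.
have CE (i : 'I_n) : C i = B (s^-1 i)%g by rewrite /C valK.
have mC j : measurable (C j) by rewrite /C; case: insubP.
have -> : [set w | forall i : 'I_n, B i (xi (s i) w)] =
    \bigcap_(j in [set` J]) (xi j @^-1` C j).
  apply/seteqP; split => w /= Bw.
    move=> j; rewrite /= inE /= mem_iota add0n => /andP[_ jn].
    by rewrite -[j]/(val (Ordinal jn)) CE -{2}[Ordinal jn](permKV s); exact: Bw.
  move=> i; rewrite -{1}[i](permK s) -CE; apply: Bw.
  by rewrite /= inE /= mem_iota add0n /= ltn_ord.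
rewrite indep//.
transitivity (\prod_(j <- iota 0 n) P (xi j @^-1` C j))%E.
  apply: perm_big; apply: uniq_perm => //; first exact: iota_uniq.
  by move=> j; rewrite inE.
rewrite -{1}(subn0 n) -/(index_iota 0 n) big_mkord.
rewrite (reindex_inj (@perm_inj _ s)).
by apply: eq_bigr => i _; rewrite CE permK; exact: law.
Qed.

Lemma measurable_data (xi : nat -> {RV P >-> T}) n :
  measurable_fun [set: Omega] (fun w => [tuple xi i w | i < n]).
Proof.
apply/measurable_fun_tnthP => i.
rewrite (_ : _ \o _ = xi i); first exact: measurable_funPT.
by apply/funext => w /=; rewrite tnth_mktuple.
Qed.

(** Rectangles form a pi-system generating the sigma-algebra of n-tuples, so a
    probability on n-tuples is determined by its values on them. *)
Lemma iid_exchangeable (F : probability T R) (xi : nat -> {RV P >-> T}) n :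
  iid F xi -> exchangeable (fun w => [tuple xi i w | i < n]).
Proof.
move=> xi_iid s B mB; set D := fun w => _.
have mD : measurable_fun [set: Omega] D by exact: measurable_data.
have msD : measurable_fun [set: Omega] (permute s \o D).
  exact: measurableT_comp (measurable_permute s) mD.
pose D1 : {mfun Omega >-> n.-tuple T} :=
  HB.pack D (isMeasurableFun.Build _ _ _ _ D mD).
pose D2 : {mfun Omega >-> n.-tuple T} :=
  HB.pack (permute s \o D) (isMeasurableFun.Build _ _ _ _ (permute s \o D) msD).
apply: (measure_unique (@rectangles _ T n) (fun=> setT) _ _ _ _
  (distribution P D2) (distribution P D1)) => //.
- exact: measurable_rectangles.
- exact: rectanglesI.
- by move=> _; exact: rectanglesT.
- exact: bigcup_const.
- move=> _ [C mC ->]; rewrite /distribution /pushforward/=.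
  transitivity (\prod_(i < n) F (C i))%E.
    rewrite -(iid_rectangle s xi_iid mC); congr (P _).
    by apply/seteqP; split => w /= Cw i; have := Cw i; rewrite !tnth_mktuple.
  rewrite -(iid_rectangle 1%g xi_iid mC); congr (P _).
  apply/seteqP; split => w /= Cw i; have := Cw i;
    by rewrite !tnth_mktuple perm1.
- by move=> _ /=; rewrite probability_setT ltry.
Qed.

End exchangeability.

(** * Conditional expectation, conditional variance and total variance *)

Section conditional_expectation_facts.
Context d (Omega : measurableType d) (R : realType).
Variables (P : probability Omega R) (G : set (set Omega)).
Hypotheses (G_sigma : sigma_algebra setT G) (G_sub : G `<=` measurable).
Implicit Types (Z Y : Omega -> R).

Let GT : G setT.
Proof. by case: G_sigma => G0 GC _; rewrite -(setD0 setT); exact: GC. Qed.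

Lemma subsigma_measurable Y :
  (forall C : set R, measurable C -> G (Y @^-1` C)) ->
  measurable_fun [set: Omega] Y.
Proof. by move=> GY _ C mC; rewrite setTI; exact/G_sub/GY. Qed.

Lemma subsigma_lt Y Y' :
  (forall C : set R, measurable C -> G (Y @^-1` C)) ->
  (forall C : set R, measurable C -> G (Y' @^-1` C)) ->
  G [set w | Y w < Y' w].
Proof.
move=> GY GY'; have Gmeas (W : Omega -> R) :
    (forall C : set R, measurable C -> G (W @^-1` C)) ->
    measurable_fun [set: g_sigma_algebraType G]
      (W : g_sigma_algebraType G -> R).
  move=> GW _ C mC; rewrite setTI; apply: sub_sigma_algebra; exact: GW.
have := measurable_fun_ltr (Gmeas _ GY) (Gmeas _ GY').
move=> /(_ measurableT [set true] I); rewrite setTI => mlt.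
by rewrite -(sigma_algebra_id G_sigma); exact: mlt.
Qed.

(** The set {Y < Y'} and its complement belong to G, hence the difference of Y
    and Y', which has a constant sign on each of them, has integral 0 there. *)
Lemma cond_expectation_unique Z Y Y' :
  is_cond_expectation P G Z Y -> is_cond_expectation P G Z Y' ->
  ae_eq P setT Y Y'.
Proof.
move=> [GY iY intY] [GY' iY' intY'].
have GA := subsigma_lt GY GY'.
have GCA : G (~` [set w | Y w < Y' w]).
  by case: G_sigma => _ GC _; rewrite -setTD; exact: GC.
have null A (f g : Omega -> R) : G A ->
    P.-integrable setT (EFin \o f) -> P.-integrable setT (EFin \o g) ->
    (\int[P]_(w in A) (f w)%:E = \int[P]_(w in A) (g w)%:E)%E ->
    (forall w, A w -> f w <= g w) ->
    ae_eq P A (fun w => (g w - f w)%:E) (cst 0%E).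
  move=> {}GA i_f i_g fg le_fg; have mA := G_sub GA.
  have i_fA : P.-integrable A (EFin \o f) by exact: integrableS i_f.
  have i_gA : P.-integrable A (EFin \o g) by exact: integrableS i_g.
  apply/(ae_eq_integral_abs P mA).
    apply/measurable_EFinP; apply: measurable_funB; apply/measurable_EFinP.
      exact: measurable_int i_gA.
    exact: measurable_int i_fA.
  under eq_integral => w /set_mem Aw do
    rewrite gee0_abs ?lee_fin ?subr_ge0 ?le_fg// EFinB.
  rewrite integralB_EFin// fg subee//.
  exact: integrable_fin_num i_gA.
have ltA := null _ _ _ GA iY iY' (etrans (intY _ GA) (esym (intY' _ GA))).
have geA := null _ _ _ GCA iY' iY (etrans (intY' _ GCA) (esym (intY _ GCA))).
have {ltA} := ltA (fun w => @ltW _ _ _ _).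
have {geA} : ae_eq P (~` [set w | Y w < Y' w])
    (fun w => (Y w - Y' w)%:E) (cst 0%E).
  by apply: geA => w /= /negP; rewrite -leNgt.
apply: filterS2 => w geA ltA _; apply/eqP; rewrite -subr_eq0.
have [YY'|Y'Y] := ltP (Y w) (Y' w).
  by have [/eqP] := ltA YY'; rewrite !subr_eq0 eq_sym.
have : (Y w - Y' w)%:E = 0%E by apply: geA => /=; apply/negP; rewrite -leNgt.
by case=> ->.
Qed.

Lemma is_cond_expectation_ae Z Z' Y :
  measurable_fun setT Z -> measurable_fun setT Z' -> ae_eq P setT Z Z' ->
  is_cond_expectation P G Z Y -> is_cond_expectation P G Z' Y.
Proof.
move=> mZ mZ' ZZ' [GY iY intY]; split => // A GA; rewrite intY//.
have mA := G_sub GA.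
apply: ae_eq_integral => //.
- by apply/measurable_EFinP; exact: measurable_funTS.
- by apply/measurable_EFinP; exact: measurable_funTS.
- by apply: filterS ZZ' => w ZZ' _; rewrite ZZ'.
Qed.

Lemma cond_expectationP Z Y : is_cond_expectation P G Z Y ->
  is_cond_expectation P G Z (cond_expectation P G Z).
Proof. by move=> ZY; apply: (@xgetPex _ (fun=> 0)); exists Y. Qed.

Lemma expectation_cond Z Y :
  is_cond_expectation P G Z Y -> ('E_P[Y] = 'E_P[Z])%E.
Proof. by move=> [_ _ intY]; rewrite unlock intY. Qed.

(** The conditional variance involves a version of E[Z | G] that need not be U;
    U may take its place because the two squared deviations agree almost surely.
    V only witnesses that the conditional expectation of the squared deviation
    exists, without which the conditional variance would be the default 0. *)
Lemma expectation_cond_variance Z U V : measurable_fun setT Z ->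
  is_cond_expectation P G Z U ->
  is_cond_expectation P G (fun w => (Z w - U w) ^+ 2) V ->
  ('E_P[cond_variance P G Z] = 'E_P[fun w => ((Z w - U w) ^+ 2)%R])%E.
Proof.
move=> mZ ZU ZUV; have ZY := cond_expectationP ZU.
have [GU _ _] := ZU; have [GY _ _] := ZY.
have mdev W : (forall C : set R, measurable C -> G (W @^-1` C)) ->
    measurable_fun setT (fun w => (Z w - W w) ^+ 2).
  move=> GW; apply: measurable_funX; apply: measurable_funB => //.
  exact: subsigma_measurable.
have dev_ae : ae_eq P setT (fun w => (Z w - U w) ^+ 2)
    (fun w => (Z w - cond_expectation P G Z w) ^+ 2).
  apply: filterS (cond_expectation_unique ZU ZY) => w UY _.
  by rewrite UY.
have ZYV := is_cond_expectation_ae (mdev _ GU) (mdev _ GY) dev_ae ZUV.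
rewrite /cond_variance (expectation_cond (cond_expectationP ZYV)).
by rewrite -(expectation_cond ZYV) (expectation_cond ZUV).
Qed.

(** Orthogonality and E[Z] = E[U] make the covariance of U and Z - U vanish. *)
Lemma variance_orthogonal_decomposition (Z U : Omega -> R) :
  Z \in Lfun P 2%:E -> U \in Lfun P 2%:E ->
  ('E_P[Z] = 'E_P[U] -> 'E_P[fun w => ((Z w - U w) * U w)%R] = 0 ->
  'V_P[Z] = 'V_P[U] + 'E_P[fun w => ((Z w - U w) ^+ 2)%R])%E.
Proof.
move=> Z2 U2 EZU orth.
have Pfin : P setT \is a fin_num := fin_num_measure P _ measurableT.
have Z1 := Lfun_subset12 Pfin Z2; have U1 := Lfun_subset12 Pfin U2.
have W2 : Z \- U \in Lfun P 2%:E by rewrite rpredB// lee1n.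
have W1 := Lfun_subset12 Pfin W2.
have EW : ('E_P[Z \- U] = 0)%E.
  by rewrite expectationB// EZU subee// expectation_fin_num.
have covUW : covariance P U (Z \- U) = 0%E.
  rewrite covarianceE ?Lfun2_mul_Lfun1//.
  have -> : 'E_P[U * (Z \- U)]%E = 0%E.
    by rewrite -orth; congr expectation; apply/funext => w; rewrite /= mulrC.
  by rewrite EW mule0 sube0.
have -> : Z = U \+ (Z \- U) by apply/funext => w /=; rewrite addrC subrK.
rewrite varianceD// covUW mule0 adde0 (varianceE W2) EW expe2 mule0 sube0.
congr (_ + 'E_P[_])%E.
by apply/funext => w /=; rewrite addrC addKr.
Qed.

End conditional_expectation_facts.

(** * Conditioning exchangeable data on the unordered values *)

Section integrals_and_laws.
Context d d' (Omega : measurableType d) (T : measurableType d') (R : realType).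
Variable P : probability Omega R.
Variables phi psi : Omega -> T.
Hypotheses (mphi : measurable_fun setT phi) (mpsi : measurable_fun setT psi).
Hypothesis same_law :
  forall B, measurable B -> P (phi @^-1` B) = P (psi @^-1` B).

Let phi_mfun : {mfun Omega >-> T} :=
  HB.pack phi (isMeasurableFun.Build _ _ _ _ phi mphi).
Let psi_mfun : {mfun Omega >-> T} :=
  HB.pack psi (isMeasurableFun.Build _ _ _ _ psi mpsi).

Let eq_integral_law (B : set T) (f : T -> \bar R) : measurable B ->
  (\int[distribution P phi_mfun]_(t in B) f t =
   \int[distribution P psi_mfun]_(t in B) f t)%E.
Proof. by move=> mB; apply: eq_measure_integral => A mA _; exact: same_law. Qed.

Lemma ge0_integral_same_law (B : set T) (f : T -> \bar R) : measurable B ->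
  measurable_fun setT f -> (forall t, 0 <= f t)%E ->
  (\int[P]_(w in phi @^-1` B) f (phi w) =
   \int[P]_(w in psi @^-1` B) f (psi w))%E.
Proof.
move=> mB mf f0; have mfB : measurable_fun B f by exact: measurable_funTS.
have f0B : {in B, forall t, (0 <= f t)%E} by move=> t _; exact: f0.
rewrite -(ge0_integral_pushforward mphi P mB mfB f0B).
rewrite -(ge0_integral_pushforward mpsi P mB mfB f0B).
exact: eq_integral_law.
Qed.

Lemma integrable_same_law (f : T -> \bar R) : measurable_fun setT f ->
  P.-integrable setT (f \o phi) -> P.-integrable setT (f \o psi).
Proof.
move=> mf /integrableP[_ foo]; apply/integrableP; split.
  exact: measurableT_comp.
have := @ge0_integral_same_law setT (fun t => `|f t|%E) measurableT.
rewrite !preimage_setT => <- //; exact: measurableT_comp.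
Qed.

Lemma integral_same_law (B : set T) (f : T -> \bar R) : measurable B ->
  measurable_fun setT f -> P.-integrable setT (f \o phi) ->
  (\int[P]_(w in phi @^-1` B) f (phi w) =
   \int[P]_(w in psi @^-1` B) f (psi w))%E.
Proof.
move=> mB mf iphi; have ipsi := integrable_same_law mf iphi.
have mpre (g : Omega -> T) : measurable_fun setT g -> measurable (g @^-1` B).
  by move=> mg; rewrite -[X in measurable X]setTI; exact: mg.
have iphiB : P.-integrable (phi @^-1` B) (f \o phi).
  by apply: integrableS iphi => //; exact: mpre.
have ipsiB : P.-integrable (psi @^-1` B) (f \o psi).
  by apply: integrableS ipsi => //; exact: mpre.
rewrite -(integral_pushforward mphi mf iphiB mB).
rewrite -(integral_pushforward mpsi mf ipsiB mB).
exact: eq_integral_law.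
Qed.

End integrals_and_laws.

Section exchangeable_data.
Context d d' (Omega : measurableType d) (T : measurableType d') (R : realType).
Variables (P : probability Omega R) (n : nat) (D : Omega -> n.-tuple T).
Hypotheses (mD : measurable_fun setT D) (exch : exchangeable P D).
Let G := sigma_unordered R D.

Lemma sigma_unordered_sigma : sigma_algebra setT G.
Proof. exact: smallest_sigma_algebra. Qed.

Lemma sigma_unordered_fun (f : n.-tuple T -> R) (C : set R) :
  measurable_fun setT f -> perm_invariant f -> measurable C ->
  G ((fun w => f (D w)) @^-1` C).
Proof.
by move=> mf fi mC; apply: sub_sigma_algebra; exists f; split => //; exists C.
Qed.

(** Sets of this form make up a sigma-algebra, and it contains the events that
    generate the unordered sigma-algebra. *)
Lemma sigma_unordered_preimage (A : set Omega) : G A ->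
  exists B : set (n.-tuple T),
    [/\ measurable B, forall s, permute s @^-1` B = B & A = D @^-1` B].
Proof.
move: A; apply: smallest_sub.
- split.
  + by exists set0; split => //; rewrite preimage_set0.
  + move=> _ [B [mB Bi ->]]; exists (~` B); split.
    * exact: measurableC.
    * by move=> s; rewrite -preimage_setC Bi.
    * by rewrite setTD preimage_setC.
  + move=> A /choice[B AB]; exists (\bigcup_k B k); split.
    * by apply: bigcupT_measurable => k; case: (AB k).
    * move=> s; rewrite preimage_bigcup; apply: eq_bigcupr => k _.
      by case: (AB k).
    * by rewrite preimage_bigcup; apply: eq_bigcupr => k _; case: (AB k).
- move=> _ [f [mf fi [C mC ->]]]; exists (f @^-1` C); split => //.
  + by rewrite -[X in measurable X]setTI; exact: mf.
  + move=> s; rewrite -comp_preimage; congr (_ @^-1` C).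
    by apply/funext => t; exact: fi.
Qed.

Lemma sigma_unordered_measurable : G `<=` measurable.
Proof.
move=> A /sigma_unordered_preimage[B [mB _ ->]].
by rewrite -[X in measurable X]setTI; exact: mD.
Qed.

Section permuted_integral.
Variable g : n.-tuple T -> R.
Hypothesis (mg : measurable_fun setT g)
  (ig : P.-integrable setT (fun w => (g (D w))%:E)).

Let same_law s B : measurable B -> P (D @^-1` B) = P ((permute s \o D) @^-1` B).
Proof. by move=> mB; rewrite exch. Qed.

Let mperm s : measurable_fun setT (permute s \o D).
Proof. exact: measurableT_comp (measurable_permute s) mD. Qed.

Let mEg : measurable_fun setT (EFin \o g). Proof. exact/measurable_EFinP. Qed.

Lemma integrable_permute s :
  P.-integrable setT (fun w => (g (permute s (D w)))%:E).
Proof. exact: (integrable_same_law mD (mperm s) (same_law s) mEg ig). Qed.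

(** A is the event that the data lies in a permutation-invariant set, so it is
    also the event that the permuted data lies in that set. *)
Lemma integral_permute s A : G A ->
  (\int[P]_(w in A) (g (permute s (D w)))%:E = \int[P]_(w in A) (g (D w))%:E)%E.
Proof.
move=> /sigma_unordered_preimage[B [mB Bi ->]].
rewrite (integral_same_law mD (mperm s) (same_law s) mB mEg ig).
by have <- : (permute s \o D) @^-1` B = D @^-1` B by rewrite -[in RHS](Bi s).
Qed.

(** Averaging [integral_permute] over all permutations gives the defining
    property of the conditional expectation. *)
Lemma cond_expectation_symmetrize :
  is_cond_expectation P G (fun w => g (D w)) (fun w => symmetrize g (D w)).
Proof.
have symE w : (symmetrize g (D w))%:E =
    ((n`!%:R^-1)%:E * \sum_(s : 'S_n) (g (permute s (D w)))%:E)%E.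
  by rewrite /symmetrize EFinM sumEFin.
have isum A : measurable A -> P.-integrable A
    (fun w => \sum_(s : 'S_n) (g (permute s (D w)))%:E)%E.
  move=> mA; apply: integrable_sum => // s _.
  by apply: integrableS (integrable_permute s).
split.
- move=> C mC; apply: sigma_unordered_fun => //.
    exact: measurable_symmetrize.
  exact: symmetrize_invariant.
- apply: eq_integrable (integrableZl _ _ (isum setT measurableT)) => //.
  by move=> w _; rewrite /= symE.
- move=> A GA; have mA := sigma_unordered_measurable GA.
  under eq_integral do rewrite symE.
  rewrite integralZl//; last exact: isum.
  rewrite integral_sum// => [|s]; last first.
    by apply: integrableS (integrable_permute s).
  under eq_bigr do rewrite integral_permute//.
  have /fineK <- : (\int[P]_(w in A) (g (D w))%:E)%E \is a fin_num.
    by apply: integrable_fin_num => //; apply: integrableS ig.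
  rewrite sumEFin sumr_const card_Sn -EFinM; congr EFin.
  by rewrite -[X in _ * X]mulr_natl mulKf// pnatr_eq0 -lt0n fact_gt0.
Qed.

End permuted_integral.
End exchangeable_data.

Lemma sqr_integrable_Lfun2 d (Omega : measurableType d) (R : realType)
    (P : probability Omega R) (f : Omega -> R) : measurable_fun setT f ->
  ('E_P[fun w => (f w ^+ 2)%R] < +oo)%E -> f \in Lfun P 2%:E.
Proof.
rewrite unlock => mf foo; rewrite inE; apply/andP; split; rewrite inE//=.
rewrite /finite_norm unlock /Lnorm poweR_lty//.
under eq_integral => w _ do rewrite /= powR_mulrn// real_normK ?num_real//.
by [].
Qed.

(** By exchangeability, all subsamples of a given size have the same law as the
    one on which the second moment is assumed to be finite. *)
Lemma exchangeable_subsample_Lfun2 d d' (Omega : measurableType d)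
    (T : measurableType d') (R : realType) (P : probability Omega R) n
    (D : Omega -> n.-tuple T) (H : seq T -> R) (e e' : seq 'I_n) :
  measurable_fun setT D -> exchangeable P D ->
  uniq e -> uniq e' -> size e = size e' ->
  measurable_fun setT (fun t : n.-tuple T => H (subsample e t)) ->
  ('E_P[fun w => (H (subsample e (D w)) ^+ 2)%R] < +oo)%E ->
  (fun w => H (subsample e' (D w))) \in Lfun P 2%:E.
Proof.
move=> mD exch ue ue' see' mH; have [s <-] := perm_extending ue ue' see'.
have msD : measurable_fun setT (permute s \o D).
  exact: measurableT_comp (measurable_permute s) mD.
move=> Hoo; rewrite (_ : (fun w => _) =
    fun w => H (subsample e (permute s (D w)))).
  apply: sqr_integrable_Lfun2; first exact: measurableT_comp mH msD.
  move: Hoo; rewrite unlock.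
  have same_law B : measurable B ->
      P (D @^-1` B) = P ((permute s \o D) @^-1` B).
    by move=> mB; rewrite exch.
  have := @ge0_integral_same_law _ _ _ _ _ P _ _ mD msD same_law setT
    (fun t => (H (subsample e t) ^+ 2)%:E) measurableT.
  rewrite !preimage_setT => <- //.
    by apply/measurable_EFinP; exact: measurable_funX.
  by move=> t; rewrite lee_fin sqr_ge0.
by apply/funext => w; rewrite subsample_permute.
Qed.

Lemma Lfun2_average d (Omega : measurableType d) (R : realType)
    (P : probability Omega R) (I : finType) (p : pred I) (c : R)
    (f : I -> Omega -> R) :
  (forall i, p i -> f i \in Lfun P 2%:E) ->
  (fun w => c * \sum_(i | p i) f i w) \in Lfun P 2%:E.
Proof.
move=> f2; rewrite (_ : (fun w => _) = c *: \sum_(i | p i) f i).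
  apply: rpredZ; [by rewrite lee1n|move=> ?].
  apply: rpred_sum => i pi; exact: f2.
by apply/funext => w; rewrite /= fct_sumE.
Qed.

(** * The variance decomposition *)

Local Open Scope ereal_scope.

Theorem theorem12 (R : realType) (d d' : measure_display)
    (Omega : measurableType d) (Xi : measurableType d') (X : Type)
    (P : probability Omega R) (F : probability Xi R)
    (xi : nat -> {RV P >-> Xi}) (h : X -> Xi -> R) (k m : nat)
    (k_ge1 : (1 <= k)%N) (m_ge1 : (1 <= m)%N)
    (xi_iid : iid F xi)
    (h_meas : forall x, measurable_fun [set: Xi] (h x))
    (H_exists : forall t : k.-tuple Xi, has_inf (range (sample_cost h k t)))
    (H_meas : measurable_fun [set: k.-tuple Xi]
                (fun t : k.-tuple Xi => opt_value h k t))
    (H_L2 : 'E_P[fun w => (opt_value h k (mkseq (xi ^~ w) k) ^+ 2)%R] < +oo) :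
  let n := (m * k)%N in
  let Z := fun w => batching_estimator h k m (xi ^~ w) in
  let U := fun w => U_statistic h k n (xi ^~ w) in
  let G := sigma_unordered R (fun w => [tuple xi i w | i < n]) in
  'V_P[Z] = 'V_P[U] + 'E_P[cond_variance P G Z] /\ 'V_P[U] <= 'V_P[Z].
Proof.
move=> n Z U G.
pose D w : n.-tuple Xi := [tuple xi i w | i < n].
have mD : measurable_fun setT D by exact: measurable_data.
have exch : exchangeable P D by exact: iid_exchangeable xi_iid.
pose H := opt_value h k; pose z := @batching_of _ Xi R X h k m.
pose u := @U_statistic_of _ Xi R X h k m.
have ZE : Z = fun w => z (D w) by apply/funext => w; exact: batching_ofE.
have UE : U = fun w => u (D w) by apply/funext => w; exact: U_statistic_ofE.
have ui : perm_invariant u := @U_statistic_of_invariant _ _ _ _ h k m.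
have sym_z : symmetrize z = u by exact: symmetrize_batching.
have mH e : size e = k ->
    measurable_fun setT (fun t : n.-tuple Xi => H (subsample e t)).
  by move=> ek; exact: (measurable_subsample ek H_meas).
have H2 e : uniq e -> size e = k ->
    (fun w => H (subsample e (D w))) \in Lfun P 2%:E.
  move=> ue ek; pose e0 := batch k (Ordinal m_ge1).
  apply: (@exchangeable_subsample_Lfun2 _ _ _ _ _ _ _ _ _ e0) => //.
  - exact: batch_uniq.
  - by rewrite size_batch.
  - by apply: mH; rewrite size_batch.
  - move: H_L2; congr (expectation P _ < _); apply/funext => w.
    congr (opt_value h k _ ^+ 2)%R.
    rewrite /mkseq -val_enum_ord /subsample -!map_comp.
    by apply: eq_map => i /=; rewrite tnth_mktuple.
have Z2 : Z \in Lfun P 2%:E.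
  rewrite ZE; apply: Lfun2_average => j _.
  by apply: H2; rewrite ?batch_uniq ?size_batch.
have U2 : U \in Lfun P 2%:E.
  rewrite UE; apply: Lfun2_average => S /eqP Sk.
  by apply: H2; rewrite ?enum_uniq// -cardE.
have mz : measurable_fun setT z.
  apply: measurable_funM => //; apply: measurable_sum => j.
  by apply: mH; rewrite size_batch.
have mu : measurable_fun setT u by rewrite -sym_z; exact: measurable_symmetrize.
have Pfin : P setT \is a fin_num := fin_num_measure P _ measurableT.
have W2 : (Z \- U)%R \in Lfun P 2%:E by rewrite rpredB// lee1n.
have ZU : is_cond_expectation P G Z U.
  rewrite UE -sym_z ZE; apply: cond_expectation_symmetrize => //.
  have := Lfun_subset12 Pfin Z2.
  by rewrite ZE => /Lfun1_integrable.
have ZUV : is_cond_expectation P G (fun w => ((Z w - U w) ^+ 2)%R)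
    (fun w => symmetrize (fun t => ((z t - u t) ^+ 2)%R) (D w)).
  rewrite ZE UE.
  apply: (@cond_expectation_symmetrize _ _ _ _ _ _ _ _ _ _
    (fun t => ((z t - u t) ^+ 2)%R)) => //.
    by apply: measurable_funX; exact: measurable_funB.
  by have := Lfun2_integrable_sqr W2; rewrite ZE UE.
have orth : 'E_P[fun w => ((Z w - U w) * U w)%R] = 0.
  have sym0 : symmetrize (fun t => (z t - u t) * u t)%R = fun=> 0%R.
    rewrite symmetrizeMr// symmetrizeB sym_z (symmetrize_id ui).
    by apply/funext => t; rewrite subrr mul0r.
  have cond0 :
      is_cond_expectation P G (fun w => ((Z w - U w) * U w)%R) (fun=> 0%R).
    rewrite ZE UE [X in is_cond_expectation _ _ _ X](_ : _ =
      fun w => symmetrize (fun t => (z t - u t) * u t)%R (D w));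
      last by rewrite sym0.
    apply: (@cond_expectation_symmetrize _ _ _ _ _ _ _ _ _ _
      (fun t => ((z t - u t) * u t)%R)) => //.
      by apply: measurable_funM => //; exact: measurable_funB.
    by have /Lfun1_integrable := Lfun2_mul_Lfun1 W2 U2; rewrite ZE UE.
  rewrite -(expectation_cond (sigma_unordered_sigma R D) cond0).
  exact: expectation_cst.
have mZ : measurable_fun setT Z by rewrite ZE; exact: measurableT_comp mz mD.
have EV := expectation_cond_variance (sigma_unordered_sigma R D)
  (sigma_unordered_measurable mD) mZ ZU ZUV.
have VZ := variance_orthogonal_decomposition Z2 U2
  (esym (expectation_cond (sigma_unordered_sigma R D) ZU)) orth.
rewrite EV; split => //; rewrite VZ leeDl//.
by apply: expectation_ge0 => w; exact: sqr_ge0.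
Qed.
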